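(* Let $Q$ be a compatible pointed irregular type, and let $\mathbb V^\flat$ and $\mathbf B_v$ ($v\in\mathbb V^\flat$) be as in the context. Then the pure local wild mapping class group $\Gamma(Q)=\pi_1(\mathbf B(Q))$ satisfies $$\Gamma(Q)\cong\prod_{v\in\mathbb V^\flat}\pi_1(\mathbf B_v),$$ and each factor is trivial or isomorphic to $\pi_1(X_n)$ (the pure braid group on $n$ strands) or to $\pi_1(X^*_{n,N})$, where $X_n=\{(a_1,\dots,a_n)\in\mathbb C^n:a_i\ne a_j\ (i\ne j)\}$ and $X^*_{n,N}=\{(a_1,\dots,a_n)\in\mathbb C^n:a_i\ne0,\ a_i\ne\zeta a_j\ (i\ne j,\ \zeta^N=1)\}$.
   Context: Exponential factors: finite sums $q=\sum_ka_kx^k$, $a_k\in\mathbb C$, $k\in\mathbb Q_{>0}$; $\mathrm{slope}(q)$ = largest exponent with nonzero coefficient; $\mathrm{ram}(q)$ = least $r\ge1$ with $q\in x^{1/r}\mathbb C[x^{1/r}]$. Galois operator $\sigma(\sum a_kx^k)=\sum a_ke^{-2\pi\sqrt{-1}k}x^k$; Stokes circle $\langle q\rangle=\{\sigma^i(q)\}$. Truncation $\tau_k(\sum a_{k'}x^{k'})=\sum_{k'\ge k}a_{k'}x^{k'}$. $\mathrm{Levels}(q)=\{\mathrm{slope}(q-\sigma^i(q))\}\setminus\{0\}$. For $L=\{k_1>\dots>k_m\}$, $r_i$ = lcm of denominators of $k_1,\dots,k_i$, $A(L)=\mathbb N_{>0}\cup\bigcup_i((0,k_i]\cap\frac1{r_i}\mathbb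 N)$. Pointed irregular type $Q=[(n_1,q_1),\dots,(n_m,q_m)]$: $n_i\in\mathbb N_{>0}$, $q_i$ in distinct orbits; compatible if $\langle\tau_k(q_i)\rangle=\langle\tau_k(q_j)\rangle\Rightarrow\tau_k(q_i)=\tau_k(q_j)$. $Q'\sim Q$ means same length and multiplicities and $\mathrm{slope}(\sigma^k(q'_i)-\sigma^l(q'_j))=\mathrm{slope}(\sigma^k(q_i)-\sigma^l(q_j))$ for all $i,j$, $0\le k\le\mathrm{ram}(q_i)$, $0\le l\le\mathrm{ram}(q_j)$. $r=\mathrm{lcm}_i\mathrm{ram}(q_i)$, $K=\max_i\mathrm{slope}(q_i)$, $s=rK$, $Q_{\mathbf a}=[(n_i,\sum_{j=1}^sa_{i,j}x^{j/r})]$, $\mathbf B(Q)=\{\mathbf a\in\mathbb C^{ms}:Q_{\mathbf a}\sim Q\}$ (based at the point giving $Q$). Fission tree: $A(Q)=\bigcup_iA(\mathrm{Levels}(q_i))$; nodes of height $k\in A(Q)$ are the circles $\langle\tau_k(q_i)\rangle$; with $k^-$ the next smaller element of $A(Q)$, the parent of $\langle\tau_{k^-}(q_i)\rangle$ is $\langle\tau_k(q_i)\rangle$. A node $\langle\tau_k(q_i)\rangle$ is admissible if $k\in A(\mathrm{Levels}(q_i))$, mandatory if $k\in\mathrm{Levels}(q_i)$; $\mathrm{Ram}(\langle\tau_k(q_i)\rangle)=\mathrm{ram}(\tau_k(q_i))$; $N_v=\mathrm{lcm}(\mathrm{Ram}(v),b)/\mathrm{Ram}(v)$ with $b$ the denominator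 of the children's height. $\eta=\lfloor K\rfloor+1$; $\mathbb V^\flat$ = nodes of height in $A(Q)\cap(0,\eta]$. For $v\in\mathbb V^\flat$, $\mathbf B_v=\{c:\mathrm{Ch}_{\mathbb A}(v)\to\mathbb C\mid c(w)\ne0$ for mandatory $w$, $c(u)^{N_v}\ne c(w)^{N_v}$ for $u\ne w\}$, where $\mathrm{Ch}_{\mathbb A}(v)$ is the set of admissible children (a point if empty). *)

(* Defs.v *)
From HB Require Import structures.
From mathcomp Require Import all_boot all_order all_algebra.
From mathcomp Require Import all_classical all_reals.
From mathcomp Require Import trigo.
From mathcomp Require Import complex.
Set Implicit Arguments. Unset Strict Implicit. Unset Printing Implicit Defensive.
Import Order.TTheory GRing.Theory Num.Theory.
Local Open Scope ring_scope.
Local Open Scope complex_scope.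

Section WildMCG.
Variable R : realType.
Local Notation C := (R[i]).

(* Paths/loops are maps R -> (I -> C); only their values on [0,1]      *)
(* matter.                                                             *)

Definition in01 (t : R) := (0 <= t) && (t <= 1).

Definition cont01 (I : Type) (f : R -> I -> C) : Prop :=
  forall t, in01 t -> forall e : R, 0 < e -> exists d : R, 0 < d /\
    forall s, in01 s -> `|s - t| < d -> forall i, `|f s i - f t i| < e%:C.

Definition cont2 (I : Type) (H : R -> R -> I -> C) : Prop :=
  forall s t, in01 s -> in01 t -> forall e : R, 0 < e -> exists d : R, 0 < d /\
    forall s' t', in01 s' -> in01 t' -> `|s' - s| < d -> `|t' - t| < d ->
      forall i, `|H s' t' i - H s t i| < e%:C.

Definition loop (I : Type) (X : (I -> C) -> Prop) (x0 : I -> C) (g : R -> I -> C) :=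
  [/\ cont01 g, (forall t, in01 t -> X (g t)), g 0 = x0 & g 1 = x0].

Definition homot (I : Type) (X : (I -> C) -> Prop) (x0 : I -> C) (g h : R -> I -> C) :=
  exists H : R -> R -> I -> C,
    [/\ cont2 H, (forall s t, in01 s -> in01 t -> X (H s t)),
        (forall t, in01 t -> H 0 t = g t /\ H 1 t = h t) &
        (forall s, in01 s -> H s 0 = x0 /\ H s 1 = x0)].

Definition concat (I : Type) (g h : R -> I -> C) : R -> I -> C :=
  fun t => if t <= 2^-1 then g (2 * t) else h (2 * t - 1).

Definition pi1_trivial (I : Type) (X : (I -> C) -> Prop) (x0 : I -> C) :=
  forall g, loop X x0 g -> homot X x0 g (fun _ => x0).

(* pi_1(X, x0) ~= pi_1(Y, y0) as groups: a map on loops that descends to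
   a well-defined, injective, surjective group morphism on homotopy classes *)
Definition pi1_iso (I J : Type) (X : (I -> C) -> Prop) (x0 : I -> C)
    (Y : (J -> C) -> Prop) (y0 : J -> C) :=
  exists phi : (R -> I -> C) -> (R -> J -> C),
  [/\ (forall g, loop X x0 g -> loop Y y0 (phi g)),
      (forall g h, loop X x0 g -> loop X x0 h ->
         (homot X x0 g h <-> homot Y y0 (phi g) (phi h))),
      (forall d, loop Y y0 d -> exists g, loop X x0 g /\ homot Y y0 (phi g) d) &
      (forall g h, loop X x0 g -> loop X x0 h ->
         homot Y y0 (phi (concat g h)) (concat (phi g) (phi h)))].

Definition pi1_iso_prod (I : Type) (X : (I -> C) -> Prop) (x0 : I -> C)
    (V : Type) (J : V -> Type) (Y : forall v, (J v -> C) -> Prop)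
    (y0 : forall v, J v -> C) :=
  exists phi : forall v, (R -> I -> C) -> (R -> J v -> C),
  [/\ (forall g, loop X x0 g -> forall v, loop (Y v) (y0 v) (phi v g)),
      (forall g h, loop X x0 g -> loop X x0 h ->
         (homot X x0 g h <-> forall v, homot (Y v) (y0 v) (phi v g) (phi v h))),
      (forall d : forall v, R -> J v -> C, (forall v, loop (Y v) (y0 v) (d v)) ->
         exists g, loop X x0 g /\ forall v, homot (Y v) (y0 v) (phi v g) (d v)) &
      (forall g h, loop X x0 g -> loop X x0 h -> forall v,
         homot (Y v) (y0 v) (phi v (concat g h)) (concat (phi v g) (phi v h)))].

Definition Xconf (n : nat) (a : 'I_n -> C) : Prop :=
  forall i j, i <> j -> a i <> a j.
Definition Xstar (n N : nat) (a : 'I_n -> C) : Prop :=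
  (forall i, a i <> 0) /\
  (forall i j (z : C), i <> j -> z ^+ N = 1 -> a i <> z * a j).

(* Exponential factors: finite sums sum_k a_k x^k, encoded as a list of *)
(* (exponent, coefficient) pairs; coefficients of equal exponents add.  *)
Definition expf := seq (rat * C).

Definition coef (q : expf) (k : rat) : C := \sum_(p <- q | p.1 == k) p.2.
Definition exps (q : expf) : seq rat := [seq p.1 | p <- q].

Definition eqf (q q' : expf) : Prop := forall k, coef q k = coef q' k.

Definition zeta (x : rat) : C :=
  (cos (2 * pi * ratr x)) +i* (- sin (2 * pi * ratr x)).

Definition sig (n : nat) (q : expf) : expf :=
  [seq (p.1, p.2 * zeta (n%:R * p.1)) | p <- q].

Definition diff (q q' : expf) : expf := q ++ [seq (p.1, - p.2) | p <- q'].

Definition trunc (k : rat) (q : expf) : expf := [seq p <- q | k <= p.1].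

(* slope: largest exponent with nonzero coefficient (0 for the zero sum) *)
Definition slope (q : expf) : rat :=
  foldr Num.max 0 [seq k <- exps q | coef q k != 0].

(* ram: least r >= 1 with q in x^{1/r} C[x^{1/r}], i.e. the lcm of the
   denominators of the exponents with nonzero coefficient *)
Definition ram (q : expf) : nat :=
  foldr lcmn 1%N [seq absz (denq k) | k <- exps q & coef q k != 0].

Definition circ (q q' : expf) : Prop := exists n : nat, eqf (sig n q) q'.

(* Levels(q) = {slope(q - sigma^i q)} \ {0}  (sigma^(ram q) = id) *)
Definition levels (q : expf) : seq rat :=
  [seq l <- [seq slope (diff q (sig i q)) | i <- iota 0 (ram q)] | l != 0].

Definition rL (L : seq rat) (l : rat) : nat :=
  foldr lcmn 1%N [seq absz (denq k) | k <- L & l <= k].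

Definition inA (L : seq rat) (k : rat) : bool :=
  (0 < k) && ((denq k == 1) ||
     has (fun l => (k <= l) && (absz (denq k) %| rL L l)%N) L).

(* Pointed irregular types Q = [(n_i, q_i)]_{i < m}                   *)
Section PIT.
Variables (m : nat) (n : 'I_m -> nat) (q : 'I_m -> expf).

Definition compatible_pit : Prop :=
  [/\ (forall i, (0 < n i)%N),
      (forall i, all (fun p => 0 < p.1) (q i)),
      (forall i j, circ (q i) (q j) -> i = j) &
      (forall (k : rat) i j, circ (trunc k (q i)) (trunc k (q j)) ->
                             eqf (trunc k (q i)) (trunc k (q j)))].

Definition rQ : nat := \big[lcmn/1%N]_(i < m) ram (q i).
Definition KQ : rat := \big[Num.max/0]_(i < m) slope (q i).
Definition sQ : nat := absz (Num.floor (KQ * rQ%:R)).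

(* Q_a, a = (a_{i,j}) with j < s standing for the exponent (j+1)/r *)
Definition qa (a : 'I_m * 'I_sQ -> C) (i : 'I_m) : expf :=
  [seq (((val j).+1)%:R / rQ%:R, a (i, j)) | j : 'I_sQ <- enum 'I_sQ].

(* Q_a ~ Q  (length and multiplicities agree by construction) *)
Definition BQ (a : 'I_m * 'I_sQ -> C) : Prop :=
  forall (i j : 'I_m) (k l : nat), (k <= ram (q i))%N -> (l <= ram (q j))%N ->
    slope (diff (sig k (qa a i)) (sig l (qa a j))) =
    slope (diff (sig k (q i)) (sig l (q j))).

Definition a0 (ij : 'I_m * 'I_sQ) : C := coef (q ij.1) ((ij.2.+1)%:R / rQ%:R).

Definition inAQ (k : rat) : Prop := exists i, inA (levels (q i)) k.

Definition predA (k' k : rat) : Prop :=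
  [/\ inAQ k', k' < k & forall k'', inAQ k'' -> k'' < k -> k'' <= k'].

(* a node of height k is the circle <tau_k(q_i)>; it is encoded by the set
   S of indices j with <tau_k(q_j)> = <tau_k(q_i)> *)
Definition isClass (k : rat) (i : 'I_m) (S : {set 'I_m}) : Prop :=
  forall j, j \in S <-> circ (trunc k (q j)) (trunc k (q i)).

Definition isNode (k : rat) (S : {set 'I_m}) : Prop :=
  inAQ k /\ exists i, isClass k i S.

Definition eta : rat := (Num.floor KQ + 1)%:~R.

Definition Vflat := {v : rat * {set 'I_m} | isNode v.1 v.2 /\ v.1 <= eta}.

Definition admissible (k : rat) (W : {set 'I_m}) : Prop :=
  exists j, j \in W /\ inA (levels (q j)) k.
Definition mandatory (k : rat) (W : {set 'I_m}) : Prop :=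
  exists j, j \in W /\ k \in levels (q j).

Definition childA (k : rat) (S : {set 'I_m}) (W : {set 'I_m}) : Prop :=
  exists k', [/\ predA k' k, (exists j, j \in S /\ isClass k' j W) & admissible k' W].

Definition ChA (k : rat) (S : {set 'I_m}) := {W : {set 'I_m} | childA k S W}.

(* Ram(v) (independent of the representative; we take the max over S) *)
Definition RamN (k : rat) (S : {set 'I_m}) : nat :=
  \max_(i in S) ram (trunc k (q i)).

Definition Nv (k : rat) (S : {set 'I_m}) (k' : rat) : nat :=
  (lcmn (RamN k S) (absz (denq k')) %/ RamN k S)%N.

Definition Bv (k : rat) (S : {set 'I_m}) (c : ChA k S -> C) : Prop :=
  forall k', predA k' k ->
    (forall w : ChA k S, mandatory k' (proj1_sig w) -> c w <> 0) /\
    (forall u w : ChA k S, proj1_sig u <> proj1_sig w ->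
        c u ^+ Nv k S k' <> c w ^+ Nv k S k').

Definition ChV (v : Vflat) := ChA (proj1_sig v).1 (proj1_sig v).2.
Definition BV (v : Vflat) : (ChV v -> C) -> Prop := @Bv (proj1_sig v).1 (proj1_sig v).2.

End PIT.
End WildMCG.

(* Main.v *)
Require Import Defs.
From HB Require Import structures.
From mathcomp Require Import all_boot all_order all_algebra.
From mathcomp Require Import all_classical all_reals.
From mathcomp Require Import trigo.
From mathcomp Require Import complex.
From mathcomp Require Import ring lra.
Import Order.TTheory GRing.Theory Num.Theory.
Local Open Scope ring_scope.

(** The space B(Q) is the product of the spaces B_v up to a selection of
    coordinates, and no deeper topology is needed.  An exponent [e] is admissible
    for [q_i] iff it is an exponent of [q_i] or its denominator divides the
    ramification of the part of [q_i] above [e]; it is a level iff the first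
    alternative holds and not the second.  Comparing slopes of differences of
    Galois conjugates, a point [a] lies in B(Q) iff [a_{i,e}] vanishes at the
    non-admissible [e], is nonzero at the levels, depends only on the circle of
    the truncation of [q_i] at [e], and at a branching of [q_i] and [q_j] at [e]
    has [a_{i,e}] and [a_{j,e}] distinct up to the Galois action that fixes the
    common part above [e], that is up to [N_v]-th roots of unity.  These are the
    equations of the product of the B_v, one coordinate per admissible node.  In
    a given B_v either [N_v = 1] and no child is a level, or [N_v > 1] and every
    admissible child is one. *)

(** * Loops and homotopies in a product given by a selection of coordinates *)

Section Loops.
Variable R : realType.

Lemma homot_refl (I : Type) (X : (I -> R[i]) -> Prop) x0 (g : R -> I -> R[i]) :
  loop X x0 g -> homot X x0 g g.
Proof.
move=> [cg Xg g0 g1]; exists (fun=> g); split=> //; last by move=> s t _; exact: Xg.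
move=> s t s01 t01 e e0; have [d [d0 dP]] := cg t t01 e e0.
by exists d; split=> // s' t' _ t'01 _ /dP; apply.
Qed.

(** Each half of the concatenation gets its own radius at [t]. If [t] lies strictly in the opposite
    half, the distance from [t] to the midpoint is a radius within which the half in question is not
    met. *)
Lemma loop_concat (I : Type) (X : (I -> R[i]) -> Prop) x0 (g h : R -> I -> R[i]) :
  loop X x0 g -> loop X x0 h -> loop X x0 (concat g h).
Proof.
move=> [cg Xg g0 g1] [ch Xh h0 h1]; rewrite /concat; split.
- move=> t t01 e e0; have /andP[t0 t1] := t01.
  have [dl [dl0 dlP]] : exists d : R, 0 < d /\ forall s, in01 s -> s <= 2^-1 ->
      `|s - t| < d -> forall i, `|g (2 * s) i - concat g h t i| < e%:C%C.
    rewrite /concat; have [th|th] := leP t 2^-1; last first.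
      exists (t - 2^-1); split; first by lra.
      by move=> s _ sh; rewrite ltr_distl; lra.
    have [|d [d0 dP]] := cg (2 * t) _ e e0; first by rewrite /in01; lra.
    exists (d / 2); split; first by lra.
    move=> s /andP[s0 s1] sh; rewrite ltr_distl => std; apply: dP.
      by rewrite /in01; lra.
    by rewrite ltr_distl; lra.
  have [dr [dr0 drP]] : exists d : R, 0 < d /\ forall s, in01 s -> 2^-1 < s ->
      `|s - t| < d -> forall i, `|h (2 * s - 1) i - concat g h t i| < e%:C%C.
    have [th|th] := ltP t 2^-1.
      exists (2^-1 - t); split; first by lra.
      by move=> s _ sh; rewrite ltr_distl; lra.
    (* At the midpoint both halves take the value [x0]. *)
    have -> : concat g h t = h (2 * t - 1).
      rewrite /concat; case: leP => // th'.
      have -> : t = 2^-1 by lra.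
      by rewrite mulfV ?pnatr_eq0// subrr g1 h0.
    have [|d [d0 dP]] := ch (2 * t - 1) _ e e0; first by rewrite /in01; lra.
    exists (d / 2); split; first by lra.
    move=> s /andP[s0 s1] sh; rewrite ltr_distl => std; apply: dP.
      by rewrite /in01; lra.
    by rewrite ltr_distl; lra.
  exists (Num.min dl dr); split; first by rewrite lt_min dl0.
  move=> s s01; rewrite lt_min => /andP[sl sr] i.
  by case: (leP s 2^-1) => hs; [exact: dlP | exact: drP].
- by move=> t /andP[t0 t1]; case: leP => th; [apply: Xg|apply: Xh]; rewrite /in01; lra.
- by rewrite ifT ?mulr0//; lra.
- by rewrite ifF ?mulr1 -?[2 - 1]/(1 + 1 - 1) ?addrK//; apply/negbTE; rewrite -ltNge; lra.
Qed.

(** Continuity, as defined for paths and homotopies, asks for one radius valid for all coordinates.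
    When a finite type enumerates them, the minimum of the separate radii serves. *)
Lemma uniform_radius (T : finType) (I : Type) (f : T -> I) (P : I -> R -> Prop) :
  (forall i, exists t, f t = i) ->
  (forall i d d', d' <= d -> P i d -> P i d') ->
  (forall i, exists d, 0 < d /\ P i d) -> exists d, 0 < d /\ forall i, P i d.
Proof.
move=> fs Pm Pe; have [D DP] := choice (fun t => Pe (f t)).
exists (\big[Num.min/1]_t D t); split.
  by rewrite lt_bigmin// => t _; case: (DP t).
move=> i; have [t <-] := fs i; case: (DP t) => _; apply: Pm.
exact: bigmin_le_cond.
Qed.

(* [idx v w] is the coordinate of [X] that the coordinate [w] of [Y v] stands
   for; [cidx] tells which coordinate of which factor a coordinate of a point
   of [X] is equal to, [None] standing for a coordinate that vanishes on [X]. *)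
Lemma pi1_iso_prod_coord (T : finType) (I : Type) (enumI : T -> I)
    (X : (I -> R[i]) -> Prop) (x0 : I -> R[i])
    (V : Type) (J : V -> Type) (Y : forall v, (J v -> R[i]) -> Prop)
    (idx : forall v, J v -> I) (cidx : I -> option {v & J v}) :
  (forall i, exists t, enumI t = i) -> X x0 ->
  (forall v w, cidx (idx v w) = Some (existT _ v w)) ->
  (forall x, X x <-> (forall v, Y v (fun w => x (idx v w))) /\
     forall i, x i = if cidx i is Some (existT v w) then x (idx v w) else 0) ->
  pi1_iso_prod X x0 Y (fun v w => x0 (idx v w)).
Proof.
move=> sI X0 idxK XP.
(* Inverse of the selection of coordinates. *)
pose glue (d : forall v, J v -> R[i]) i :=
  if cidx i is Some (existT v w) then d v w else 0.
have glueK d v w : glue d (idx v w) = d v w by rewrite /glue idxK.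
have gluex x : X x -> glue (fun v w => x (idx v w)) = x.
  by move=> /XP[_ xE]; apply/funext => i; rewrite /glue -xE.
have Xglue d : (forall v, Y v (d v)) -> X (glue d).
  move=> Yd; apply/XP; split=> [v|i].
    by rewrite (_ : (fun _ => _) = d v)//; apply/funext => w; rewrite glueK.
  by rewrite {1}/glue; case: (cidx i) => // -[v w]; rewrite glueK.
have loopP g : loop X x0 g ->
    forall v, loop (Y v) (fun w => x0 (idx v w)) (fun t w => g t (idx v w)).
  move=> [cg Xg g0 g1] v; split.
  - move=> t t01 e e0; have [d [d0 dP]] := cg t t01 e e0.
    by exists d; split=> // s s01 st w; apply: dP.
  - by move=> t /Xg /XP[+ _]; apply.
  - by rewrite g0.
  - by rewrite g1.
exists (fun v g t w => g t (idx v w)); split=> //.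
- move=> g h lg lh; split.
    move=> [H [cH XH H01 Hb]] v; exists (fun s t w => H s t (idx v w)); split.
    + move=> s t s01 t01 e e0; have [d [d0 dP]] := cH s t s01 t01 e e0.
      by exists d; split=> // s' t' *; apply: dP.
    + by move=> s t s01 t01; have /XP[+ _] := XH s t s01 t01; apply.
    + by move=> t /H01[-> ->].
    + by move=> s /Hb[-> ->].
  move=> Hv; pose H v := projT1 (cid (Hv v)).
  have HP v := projT2 (cid (Hv v)).
  exists (fun s t => glue (fun v => H v s t)); split.
  (* Each coordinate of the glued map is constant or comes from a single factor, so it is continuous
     by itself; [V] may be infinite, but the coordinates are finitely many. *)
  + move=> s t s01 t01 e e0; pose P i (d : R) := forall s' t', in01 s' -> in01 t' ->
      `|s' - s| < d -> `|t' - t| < d ->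
      `|glue (fun v => H v s' t') i - glue (fun v => H v s t) i| < e%:C%C.
    have [|i|d [d0 dP]] := @uniform_radius T I enumI P sI.
    * move=> i d d' d'd Pd s' t' s'01 t'01 s's t't.
      by apply: Pd => //; apply: lt_le_trans d'd.
    * rewrite /P /glue; case: (cidx i) => [[v w]|]; last first.
        by exists 1; split=> // *; rewrite subrr normr0 ltcR.
      have [cH _ _ _] := HP v; have [d [d0 dP]] := cH s t s01 t01 e e0.
      by exists d; split=> // *; apply: dP.
    * by exists d; split=> // *; apply: dP.
  + by move=> s t s01 t01; apply: Xglue => v; case: (HP v) => _ + _ _; apply.
  + move=> t t01; have [_ Xg _ _] := lg; have [_ Xh _ _] := lh.
    rewrite -(gluex _ (Xg t t01)) -(gluex _ (Xh t t01)).
    by split; congr glue; apply: functional_extensionality_dep => v;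
      have [_ _ /(_ t t01)[]] := HP v.
  + move=> s s01; rewrite -(gluex x0 X0).
    by split; congr glue; apply: functional_extensionality_dep => v;
      have [_ _ _ /(_ s s01)[]] := HP v.
- move=> d ld; exists (fun t => glue (fun v => d v t)).
  split.
    split.
    + move=> t t01 e e0; pose P i (r : R) := forall s, in01 s -> `|s - t| < r ->
        `|glue (fun v => d v s) i - glue (fun v => d v t) i| < e%:C%C.
      have [|i|r [r0 rP]] := @uniform_radius T I enumI P sI.
      * by move=> i r r' r'r Pr s s01 st; apply: Pr => //; apply: lt_le_trans r'r.
      * rewrite /P /glue; case: (cidx i) => [[v w]|]; last first.
          by exists 1; split=> // *; rewrite subrr normr0 ltcR.
        have [cd _ _ _] := ld v; have [r [r0 rP]] := cd t t01 e e0.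
        by exists r; split=> // *; apply: rP.
      * by exists r; split=> // *; apply: rP.
    + by move=> t t01; apply: Xglue => v; case: (ld v) => _ + _ _; apply.
    + rewrite -(gluex x0 X0); congr glue; apply: functional_extensionality_dep => v.
      by case: (ld v).
    + rewrite -(gluex x0 X0); congr glue; apply: functional_extensionality_dep => v.
      by case: (ld v).
  move=> v; rewrite (_ : (fun _ _ => _) = d v); first exact: homot_refl.
  by apply/funext => t; apply/funext => w; rewrite glueK.
- move=> g h lg lh v.
  rewrite (_ : (fun t w => concat g h t (idx v w)) =
    concat (fun t w => g t (idx v w)) (fun t w => h t (idx v w))).
    by apply: homot_refl; apply: loop_concat; apply: loopP.
  by apply/funext => t; apply/funext => w; rewrite /concat; case: ifP.
Qed.

(** A product with the single index [tt], in which no coordinate is forced to vanish. *)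
Lemma pi1_iso_reindex (k : nat) (I : Type) (e : 'I_k -> I) (e' : I -> 'I_k)
    (X : (I -> R[i]) -> Prop) (x0 : I -> R[i]) (Y : ('I_k -> R[i]) -> Prop) :
  cancel e e' -> cancel e' e -> X x0 -> (forall x, X x <-> Y (x \o e)) ->
  pi1_iso X x0 Y (x0 \o e).
Proof.
move=> eK e'K Xx0 XP.
have [||||phi [P1 P2 P3 P4]] := @pi1_iso_prod_coord 'I_k I e X x0 unit (fun=> 'I_k)
  (fun=> Y) (fun=> e) (fun i => Some (existT _ tt (e' i))).
- by move=> i; exists (e' i).
- by [].
- by move=> [] w; rewrite eK.
- move=> x; rewrite XP; split=> [Yx|[/(_ tt)//]].
  by split=> // i; rewrite e'K.
exists (phi tt); split=> [g lg|g h lg lh|d ld|g h lg lh]; [exact: P1| | |exact: P4].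
- by rewrite P2//; split=> [/(_ tt)//|+ []].
- by have [g [lg gP]] := P3 (fun=> d) (fun=> ld); exists g; split=> //; exact: gP.
Qed.

End Loops.

(** * Denominators and the roots of unity exp(-2 pi i x) *)

Lemma rat_int_mul (t : int) (x : rat) :
  (t%:~R * x \is a Num.int) = (denq x %| t)%Z.
Proof.
have d0 : (denq x)%:Q != 0 by rewrite intr_eq0 denq_neq0.
rewrite -(@Gauss_dvdzl (denq x) t (numq x)); last first.
  by rewrite coprimezE coprime_sym coprime_num_den.
apply/idP/idP => [/intrP[z E]|].
  by apply/dvdzP; exists z; apply/eqP; rewrite -(eqr_int rat) !intrM numqE mulrA E.
by move=> /Qint_dvdz; rewrite intrM -mulrA divq_num_den.
Qed.

Section Zeta.
Variable R : realType.
Local Notation zeta := (@zeta R).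

Lemma zetaD x y : zeta (x + y) = zeta x * zeta y.
Proof.
rewrite /Defs.zeta rmorphD/= mulrDr cosD sinD.
by apply/eqP; rewrite eq_complex/=; apply/andP; split; apply/eqP; ring.
Qed.

Lemma zeta0 : zeta 0 = 1.
Proof. by rewrite /Defs.zeta rmorph0 mulr0 cos0 sin0 oppr0. Qed.

Lemma zeta_neq0 x : zeta x != 0.
Proof.
apply/eqP => z0; have := zetaD x (- x).
by rewrite subrr z0 mul0r zeta0 => /eqP; rewrite oner_eq0.
Qed.

Lemma zetaX x n : zeta x ^+ n = zeta (n%:R * x).
Proof.
elim: n => [|n IH]; first by rewrite expr0 mul0r zeta0.
by rewrite exprS IH -zetaD -natr1 mulrDl mul1r addrC.
Qed.

Lemma zeta_nat (n : nat) : zeta n%:R = 1.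
Proof.
rewrite -(mulr1 n%:R) -zetaX [zeta 1](_ : _ = 1) ?expr1n//.
by rewrite /Defs.zeta rmorph1 mulr1 mulr_natl cos2pi sin2pi oppr0.
Qed.

Lemma zeta_int (z : int) : zeta z%:~R = 1.
Proof.
case: z => n; first exact: zeta_nat.
have := zetaD (Negz n)%:~R n.+1%:R; rewrite zeta_nat mulr1 => <-.
by rewrite NegzE rmorphN /= addNr zeta0.
Qed.

(** Only the fractional part y of [x] matters. If 0 < y < 1 then sin (pi y) > 0, so the real part 1
    - 2 sin^2 (pi y) of [zeta y] is less than 1. *)
Lemma zeta_eq1 x : (zeta x == 1) = (x \is a Num.int).
Proof.
apply/idP/idP => [/eqP z1|/intrP[z ->]]; last by rewrite zeta_int.
have /andP[fx xf] := floor_itv x; pose y := x - (Num.floor x)%:~R.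
have y0 : 0 <= y by rewrite subr_ge0.
have y1 : y < 1 by rewrite ltrBlDl -intrD1.
have : zeta y = 1.
  by have := zetaD y (Num.floor x)%:~R; rewrite subrK zeta_int mulr1 z1.
have [/eqP|yn0] := eqVneq y 0; first by rewrite subr_eq0 => /eqP -> _; rewrite intr_int.
move=> /(congr1 (@complex.Re R)) /=.
have py : 0 < (pi : R) * ratr y < pi.
  rewrite pmulr_rgt0 ?pi_gt0// ltr0q lt_def yn0 y0/= gtr_pMr ?pi_gt0//.
  by rewrite -[X in _ < X](rmorph1 (@ratr R)) ltr_rat.
have s0 := sin_gt0_pi py.
rewrite -mulrA mulr_natl cos_mulr2n => c1.
have := cos2Dsin2 (pi * ratr y : R).
have : 0 < sin (pi * ratr y : R) ^+ 2 by rewrite exprn_gt0.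
by move: c1; rewrite mulr2n; lra.
Qed.

(** Turns each comparison of two Galois powers on a term of exponent [x] into a divisibility. The
    difference is an integer, so that [n] may be smaller than [m]. *)
Lemma zeta_natM_eq (n m : nat) x :
  (zeta (n%:R * x) == zeta (m%:R * x)) = (denq x %| n%:Z - m%:Z)%Z.
Proof.
rewrite -rat_int_mul -zeta_eq1 intrB mulrBl zetaD.
have /eqP <- : zeta (m%:R * x) * zeta (- (m%:R * x)) == 1.
  by rewrite -zetaD subrr zeta0.
by rewrite (inj_eq (mulIf _))// zeta_neq0.
Qed.

End Zeta.

(** * Slope, ramification, levels and admissible exponents of one exponential factor *)

Section ExpFactors.
Variable R : realType.
Implicit Types (q : expf R) (e k l : rat) (s : seq rat).

Definition lcmden s : nat := foldr lcmn 1%N [seq absz (denq k) | k <- s].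

Lemma dvd_lcmden s (t : int) :
  reflect (forall k, k \in s -> (denq k %| t)%Z) ((lcmden s)%:Z %| t)%Z.
Proof.
apply: (iffP idP); rewrite /lcmden.
  elim: s => //= k s IH; rewrite dvdzE /= dvdn_lcm => /andP[kt /IH{}IH] k'.
  by rewrite inE => /predU1P[->|/IH].
elim: s => [_|k s IH kt] /=; first by rewrite dvd1z.
rewrite dvdzE /= dvdn_lcm; apply/andP; split.
  by have := kt k; rewrite inE eqxx => /(_ isT).
by apply: IH => k' ks; apply: kt; rewrite inE ks orbT.
Qed.

Lemma den_dvd_lcmden s k : k \in s -> (denq k %| (lcmden s)%:Z)%Z.
Proof. by move: k; apply/dvd_lcmden; rewrite dvdzz. Qed.

Lemma lcmden_gt0 s : (0 < lcmden s)%N.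
Proof. by elim: s => //= k s IH; rewrite lcmn_gt0 absz_gt0 denq_neq0. Qed.

Lemma coef_sig n q k : coef (sig n q) k = coef q k * zeta R (n%:R * k).
Proof.
rewrite /coef big_map mulr_suml.
by apply: eq_bigr => p /= /eqP ->.
Qed.

Lemma coef_diff q q' k : coef (diff q q') k = coef q k - coef q' k.
Proof. by rewrite /coef big_cat big_map /= sumrN. Qed.

Lemma coef_trunc l q k : coef (trunc l q) k = if l <= k then coef q k else 0.
Proof.
rewrite /coef big_filter_cond; case: ifP => lk.
  by apply: eq_bigl => p; case: eqP => [->|]; rewrite ?lk ?andbF.
by rewrite big1// => p /andP[+ /eqP pk]; rewrite pk lk.
Qed.

Lemma coef_exps q k : coef q k != 0 -> k \in exps q.
Proof.
apply: contraR => kq; apply/eqP/big1_seq => p /andP[/eqP pk pq].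
by move: kq; rewrite -pk map_f.
Qed.

(** These properties determine the slope, as [slope_eq] shows, and replace the fold from here on.
    The last one is conditional because 0 is also the slope of the zero sum. *)
Lemma slope_spec q : [/\ 0 <= slope q, forall k, slope q < k -> coef q k = 0 &
  0 < slope q -> coef q (slope q) != 0].
Proof.
rewrite /slope; set s := (X in foldr _ _ X).
have s0 : 0 <= foldr Num.max 0 s.
  by elim: s => //= k s IH; rewrite le_max IH orbT.
have sm k : k \in s -> k <= foldr Num.max 0 s.
  elim: (s) => //= k' s' IH; rewrite inE le_max => /predU1P[->|/IH ->].
    by rewrite lexx.
  by rewrite orbT.
have sin : 0 < foldr Num.max 0 s -> foldr Num.max 0 s \in s.
  elim: (s) => [|k' s' IH] /=; first by rewrite ltxx.
  rewrite inE; case: (leP k' (foldr Num.max 0 s')) => [_ h|]; last by rewrite eqxx.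
  by rewrite (IH h) orbT.
split=> // [k ks|/sin]; last by rewrite mem_filter => /andP[].
apply/eqP; apply: contraTT ks => k0; rewrite -leNgt sm//.
by rewrite mem_filter k0 coef_exps.
Qed.

Lemma slope_eq q e : 0 <= e -> (forall k, e < k -> coef q k = 0) ->
  (0 < e -> coef q e != 0) -> slope q = e.
Proof.
move=> e0 ek eq0; have [s0 sk sq0] := slope_spec q.
have [se|es|//] := ltgtP (slope q) e.
  by move: (eq0 (le_lt_trans s0 se)); rewrite sk// eqxx.
by move: (sq0 (le_lt_trans e0 es)); rewrite ek// eqxx.
Qed.

Lemma slope_lt q e : 0 < e -> (forall k, e <= k -> coef q k = 0) -> slope q < e.
Proof.
move=> e0 ek; have [s0 sk sq0] := slope_spec q; rewrite ltNge; apply/negP => es.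
by move: (sq0 (lt_le_trans e0 es)); rewrite ek// eqxx.
Qed.

Lemma dvd_ram q (t : int) :
  reflect (forall k, coef q k != 0 -> (denq k %| t)%Z) ((ram q)%:Z %| t)%Z.
Proof.
apply: (iffP (dvd_lcmden _ _)) => h k.
  by move=> k0; apply: h; rewrite mem_filter k0 coef_exps.
by rewrite mem_filter => /andP[k0 _]; apply: h.
Qed.

Lemma den_dvd_ram q k : coef q k != 0 -> (denq k %| (ram q)%:Z)%Z.
Proof. by move: k; apply/dvd_ram; rewrite dvdzz. Qed.

Lemma ram_gt0 q : (0 < ram q)%N.
Proof. exact: lcmden_gt0. Qed.

(** The least positive power of the Galois operator that fixes the part of [q] strictly above
    [e]. *)
Definition ram_above q e : nat :=
  lcmden [seq k <- exps q | (coef q k != 0) && (e < k)].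

Lemma dvd_ram_above q e (t : int) :
  reflect (forall k, e < k -> coef q k != 0 -> (denq k %| t)%Z)
          ((ram_above q e)%:Z %| t)%Z.
Proof.
apply: (iffP (dvd_lcmden _ _)) => h k.
  by move=> ek k0; apply: h; rewrite mem_filter k0 ek coef_exps.
by rewrite mem_filter => /andP[/andP[k0 ek] _]; apply: h.
Qed.

Lemma den_dvd_ram_above q e k :
  e < k -> coef q k != 0 -> (denq k %| (ram_above q e)%:Z)%Z.
Proof. by move: k; apply/dvd_ram_above; rewrite dvdzz. Qed.

Lemma ram_above_dvd_ram q e : (ram_above q e %| ram q)%N.
Proof.
rewrite -[(_ %| _)%N]/(Posz _ %| Posz _)%Z.
by apply/dvd_ram_above => k _; exact: den_dvd_ram.
Qed.

(* A term of exponent [e] would not increase the ramification of the part of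
   [q] above [e]. *)
Definition unram q e : bool := (denq e %| (ram_above q e)%:Z)%Z.

Lemma unramP q e (t : int) : unram q e ->
  (forall k, e < k -> coef q k != 0 -> (denq k %| t)%Z) -> (denq e %| t)%Z.
Proof. by move=> u /dvd_ram_above; apply: dvdz_trans. Qed.

(** The slope of [q] minus its conjugate by the power [i] is the largest exponent of [q] whose
    denominator does not divide [i]. For [k] to be that exponent, [i] must be divisible by all
    denominators above [k] but not by that of [k]. *)
Lemma mem_levels q k :
  k \in levels q = [&& 0 < k, coef q k != 0 & ~~ unram q k].
Proof.
have cd i l : coef (diff q (sig i q)) l != 0 =
    (coef q l != 0) && ~~ (denq l %| i%:Z)%Z.
  rewrite coef_diff coef_sig -{1}[coef q l]mulr1 -mulrBr mulf_eq0 negb_or.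
  congr (_ && ~~ _); rewrite subr_eq0 -[1](zeta0 R) -(mul0r l) eq_sym.
  by rewrite (zeta_natM_eq R i 0) subr0.
rewrite mem_filter; apply/andP/and3P.
  move=> [k0 /mapP[i _ kE]]; have [s0 sk sq0] := slope_spec (diff q (sig i q)).
  rewrite -kE in s0 sk sq0; have {}k0 : 0 < k by rewrite lt_def k0.
  move: (sq0 k0); rewrite cd => /andP[-> ndk]; split=> //.
  apply: contra ndk => /unramP; apply => l kl l0.
  by move: (cd i l); rewrite sk// eqxx l0 /= => /esym/negbFE.
move=> [k0 ck nu]; split; first by rewrite gt_eqF.
(* This power lies in the range of [levels]: it divides [ram q], and equality would make [k]
   unramified. *)
apply/mapP; exists (ram_above q k).
  rewrite mem_iota /= add0n ltn_neqAle dvdn_leq ?ram_gt0 ?ram_above_dvd_ram// andbT.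
  apply: contra nu => /eqP E; rewrite /unram E.
  exact: den_dvd_ram.
apply/esym/slope_eq; first exact: ltW.
  move=> l kl; apply/eqP; rewrite -[_ == 0]negbK cd negb_and !negbK.
  by case: eqVneq => //= l0; exact: den_dvd_ram_above.
by move=> _; rewrite cd ck.
Qed.

(* Every exponent of [q] is ramified or has its denominator absorbed by the
   exponents above it, so that the denominators of the levels suffice. *)
Lemma dvd_levels_above q e (t : int) : 0 <= e ->
  (forall l, l \in levels q -> e < l -> (denq l %| t)%Z) ->
  forall k, e < k -> coef q k != 0 -> (denq k %| t)%Z.
Proof.
(* Induction on the number of listed exponents above [k]: passing to a larger exponent [l], the
   entry [l] itself stops being counted. *)
move=> e0 lt k; have [N] := ubnP (count (fun l => k < l) (exps q)).
elim: N k => // N IH k kN ek k0.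
have [u|nu] := boolP (unram q k); last first.
  by apply: lt => //; rewrite mem_levels (le_lt_trans e0 ek) k0.
apply: unramP u _ => l kl l0; apply: IH => //; last exact: lt_trans kl.
rewrite -ltnS; apply: leq_trans kN.
have lq : (0 < count (pred1 l) (exps q))%N by rewrite -has_count has_pred1 coef_exps.
rewrite ltnS -addn1; apply: (@leq_trans (count (fun l' => (l < l')%R) (exps q) +
  count (pred1 l) (exps q))%N); first by rewrite leq_add2l.
rewrite -count_predUI [X in (_ + X)%N](_ : _ = 0%N); last first.
  by rewrite -[RHS](count_pred0 (exps q)); apply: eq_count => x /=; case: (ltgtP l x).
rewrite addn0; apply: sub_count => x /= /orP[|/eqP->//]; exact: lt_trans.
Qed.

(** Replaces the definition of A(L) through levels by a local test on the coefficients. For an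
    unramified [k], the least level above [k] is the witness: by [dvd_levels_above] the levels from
    it on absorb all denominators above [k]. *)
Lemma inA_levels q k :
  inA (levels q) k = (0 < k) && (unram q k || (coef q k != 0)).
Proof.
rewrite /inA; case: (ltP 0 k) => //= k0.
apply/orP/orP.
  case=> [/eqP d1|/hasP[l lL /andP[kl dk]]]; first by left; rewrite /unram d1 dvd1z.
  have [->|nkl] := eqVneq k l; first by right; move: lL; rewrite mem_levels => /and3P[].
  left; apply: (@dvdz_trans (rL (levels q) l)); first by rewrite dvdzE.
  apply/dvd_lcmden => l'; rewrite mem_filter mem_levels => /andP[ll' /and3P[_ cl' _]].
  have : k < l' by apply: lt_le_trans ll'; rewrite lt_neqAle nkl.
  by move=> kl'; exact: den_dvd_ram_above.
have [u _|nu [//|ck]] := boolP (unram q k); last first.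
  right; apply/hasP; exists k; first by rewrite mem_levels k0 ck.
  rewrite lexx /= -[(_ %| _)%N]/(denq k %| (rL (levels q) k)%:Z)%Z.
  have : k \in [seq l <- levels q | k <= l] by rewrite mem_filter lexx mem_levels k0 ck.
  exact: den_dvd_lcmden.
pose L := [seq l <- levels q | k < l].
have [/eqP L0|/hasP[l lL lmin]] : L == [::] \/ has (fun l => all (fun l' => l <= l') L) L.
  elim: (L) => [|l s IH]; [by left|right]; case: IH => [/eqP->|].
    by rewrite /= lexx.
  move=> /hasP[l' l's /allP l'min]; apply/hasP; have [ll'|l'l] := leP l l'.
    exists l; first by rewrite mem_head.
    by rewrite /= lexx; apply/allP => x /l'min; apply: le_trans.
  exists l'; first by rewrite inE l's orbT.
  by rewrite /= (ltW l'l); apply/allP.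
  (* Without a level above [k] all exponents above [k] are integers, hence so is [k]. *)
  left; suff : (denq k %| 1)%Z by rewrite dvdz1; case: (denq k) (denq_gt0 k).
  apply: unramP u _; apply: dvd_levels_above; first exact: ltW.
  move=> l lq kl; have : l \in L by rewrite mem_filter kl.
  by rewrite L0.
right; move: (lL); rewrite mem_filter => /andP[kl lq]; apply/hasP; exists l => //.
rewrite (ltW kl) /= -[(_ %| _)%N]/(denq k %| (rL (levels q) l)%:Z)%Z.
apply: unramP u _; apply: dvd_levels_above; first exact: ltW.
move=> l' l'q kl'; have : l' \in [seq l' <- levels q | l <= l'].
  by rewrite mem_filter l'q andbT (allP lmin)// mem_filter kl'.
exact: den_dvd_lcmden.
Qed.

Lemma ram_above_eq q q' e : (forall k, e < k -> coef q k = coef q' k) ->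
  ram_above q e = ram_above q' e.
Proof.
move=> qq'; apply/eqP; rewrite eqn_dvd; apply/andP; split;
  rewrite -[(_ %| _)%N]/(Posz _ %| Posz _)%Z; apply/dvd_ram_above => k ek.
- by rewrite qq'//; exact: den_dvd_ram_above.
- by rewrite -qq'//; exact: den_dvd_ram_above.
Qed.

Lemma unram_eq q q' e : (forall k, e < k -> coef q k = coef q' k) ->
  unram q e = unram q' e.
Proof. by rewrite /unram => /ram_above_eq ->. Qed.

Lemma coef_diff_sig a b q q' k : coef (diff (sig a q) (sig b q')) k =
  coef q k * zeta R (a%:R * k) - coef q' k * zeta R (b%:R * k).
Proof. by rewrite coef_diff !coef_sig. Qed.

Lemma zeta_modn (a r : nat) e : (denq e %| r%:Z)%Z ->
  zeta R ((a %% r)%N%:R * e) = zeta R (a%:R * e).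
Proof.
move=> er; apply/eqP; rewrite zeta_natM_eq; apply: dvdz_trans er _.
apply/dvdzP; exists (- (a %/ r)%N%:Z).
by rewrite {2}(divn_eq a r) PoszD PoszM; ring.
Qed.

(** The number [zeta (r e)] has order lcm(r, d) / r, where d is the denominator of [e], so it is a
    primitive [N]-th root of unity. Thus equality of [N]-th powers is equality up to those Galois
    powers that are multiples of [r]. *)
Lemma expr_eq_zetaP (r : nat) e (c d : R[i]) : (0 < r)%N ->
  let N := (lcmn r (absz (denq e)) %/ r)%N in
  c ^+ N = d ^+ N <-> exists t : nat, c = d * zeta R ((t * r)%N%:R * e).
Proof.
move=> r0 N; have NE : (N * r = lcmn r (absz (denq e)))%N.
  by rewrite divnK// dvdn_lcml.
have N0 : (0 < N)%N.
  have : (0 < N * r)%N by rewrite NE lcmn_gt0 r0 absz_gt0 denq_neq0.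
  by rewrite muln_gt0 => /andP[].
have zE t : zeta R (r%:R * e) ^+ t = zeta R ((t * r)%N%:R * e).
  by rewrite zetaX mulrA natrM.
have z1 t : (zeta R (r%:R * e) ^+ t == 1) = (N %| t)%N.
  rewrite zE -(zeta0 R) -(mul0r e) (zeta_natM_eq R _ 0) subr0 dvdzE /=.
  by rewrite -(@dvdn_pmul2r r N)// NE dvdn_lcm (@dvdn_mull r t r).
have prim : N.-primitive_root (zeta R (r%:R * e)).
  have [|p pP pN] := prim_order_exists N0 (z := zeta R (r%:R * e)).
    by apply/eqP; rewrite z1.
  suff -> : N = p by [].
  by apply/eqP; rewrite eqn_dvd pN andbT -z1 prim_expr_order.
split=> [cd|[t ->]]; last first.
  by rewrite exprMn -zE -exprM mulnC exprM (prim_expr_order prim) expr1n mulr1.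
have [d0|d0] := eqVneq d 0.
  exists 0%N; move/eqP: cd; rewrite d0 mul0r expr0n (gtn_eqF N0) /=.
  by rewrite expf_eq0 N0 => /eqP.
have [|t tE] := prim_rootP prim (x := c / d).
  by rewrite expr_div_n cd divff// expf_neq0.
by exists t; rewrite -zE -tE mulrC divfK.
Qed.

Lemma lcmn_div_eq1 (r d : nat) : (0 < r)%N -> (0 < d)%N ->
  (lcmn r d %/ r == 1)%N = (d %| r)%N.
Proof.
move=> r0 d0; rewrite -(eqn_pmul2r r0) divnK ?dvdn_lcml// mul1n.
by apply/eqP/idP => [<-|/lcmn_idPl//]; exact: dvdn_lcmr.
Qed.

End ExpFactors.

(** * Agreement of the truncations in a compatible irregular type *)

Section FissionTree.
Variables (R : realType) (m : nat) (n : 'I_m -> nat) (q : 'I_m -> expf R).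
Hypothesis Qc : compatible_pit n q.
Implicit Types (e k l : rat) (i j : 'I_m) (S W : {set 'I_m}).
Local Notation s := (sQ q).
Local Notation r := (rQ q).
Local Notation K := (KQ q).
Local Notation adm i := (inA (levels (q i))).

(** By compatibility this is equality of the circles of the truncations at [e] ([circ_trunc]), so
    the tree can be handled through coefficients alone. *)
Definition agree_ge i j e := forall k, e <= k -> coef (q i) k = coef (q j) k.
Definition agree_gt i j e := forall k, e < k -> coef (q i) k = coef (q j) k.

Lemma agree_ge_sym i j e : agree_ge i j e -> agree_ge j i e.
Proof. by move=> h k /h. Qed.

Lemma agree_ge_trans i j i' e : agree_ge i j e -> agree_ge j i' e -> agree_ge i i' e.
Proof. by move=> h h' k ek; rewrite h// h'. Qed.

Lemma agree_geW i j e e' : e <= e' -> agree_ge i j e -> agree_ge i j e'.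
Proof. by move=> ee' h k e'k; rewrite h// (le_trans ee'). Qed.

Lemma agree_ge_gt i j e : agree_ge i j e -> agree_gt i j e.
Proof. by move=> h k /ltW /h. Qed.

Lemma coef_gt0 i k : coef (q i) k != 0 -> 0 < k.
Proof.
have [_ pq _ _] := Qc; move=> /coef_exps /mapP[p pi ->].
exact: (allP (pq i)).
Qed.

(** If some conjugates of [q i] and [q j] coincide from [e] up, the truncations lie on one circle,
    and compatibility makes the truncations themselves equal. *)
Lemma agree_of_sig i j e (a b : nat) :
  (forall k, e <= k -> coef (q i) k * zeta R (a%:R * k) =
                       coef (q j) k * zeta R (b%:R * k)) -> agree_ge i j e.
Proof.
move=> ij; have [_ _ _ /(_ e i j)] := Qc.
have /[swap]/[apply] : circ (trunc e (q i)) (trunc e (q j)).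
  (* The power [ram (q j)] fixes [q j], so the power [b * (ram (q j)).-1] undoes the power [b]. *)
  exists (a + b * (ram (q j)).-1)%N => k; rewrite coef_sig !coef_trunc.
  case: leP => ek; last by rewrite mul0r.
  rewrite natrD mulrDl zetaD mulrA ij// -mulrA -zetaD -mulrDl -natrD.
  have [->|k0] := eqVneq (coef (q j) k) 0; first by rewrite mul0r.
  rewrite -[X in (X + _)%N]muln1 -mulnDr add1n prednK ?ram_gt0//.
  rewrite [zeta R _](_ : _ = 1) ?mulr1//.
  apply/eqP; rewrite -(zeta0 R) -(mul0r k) (zeta_natM_eq R _ 0) subr0.
  by rewrite PoszM dvdz_mull// den_dvd_ram.
by move=> h k ek; have := h k; rewrite !coef_trunc ek.
Qed.

Lemma circ_trunc i j e : circ (trunc e (q i)) (trunc e (q j)) <-> agree_ge i j e.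
Proof.
split=> [c|ij].
  have [_ _ _ /(_ e i j c) h] := Qc.
  by move=> k ek; have := h k; rewrite !coef_trunc ek.
exists 0%N => k; rewrite coef_sig mul0r zeta0 mulr1 !coef_trunc.
by case: ifP => // /ij.
Qed.

Lemma isClassP k i S : isClass q k i S <-> forall j, j \in S <-> agree_ge j i k.
Proof. by split=> h j; rewrite h circ_trunc. Qed.

Lemma adm_agree i j e : agree_ge i j e -> adm i e = adm j e.
Proof.
move=> ij; rewrite !inA_levels (ij e)// (unram_eq _ _ (q j))//.
exact: agree_ge_gt.
Qed.

Lemma levels_agree i j e : agree_ge i j e ->
  (e \in levels (q i)) = (e \in levels (q j)).
Proof.
move=> ij; rewrite !mem_levels (ij e)// (unram_eq _ _ (q j))//.
exact: agree_ge_gt.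
Qed.

Lemma adm_gt0 i e : adm i e -> 0 < e.
Proof. by case/andP. Qed.

Lemma coef_adm i e : coef (q i) e != 0 -> adm i e.
Proof. by move=> e0; rewrite inA_levels e0 orbT (coef_gt0 _ _ e0). Qed.

Lemma adm_dvd i e : adm i e -> (denq e %| (ram (q i))%:Z)%Z.
Proof.
rewrite inA_levels => /andP[_ /orP[u|]]; last exact: den_dvd_ram.
by apply: dvdz_trans u _; exact: ram_above_dvd_ram.
Qed.

Lemma ram_dvd_rQ i : (ram (q i) %| r)%N.
Proof. exact: biglcmn_sup. Qed.

Lemma rQ_gt0 : (0 < r)%N.
Proof.
rewrite /rQ; elim/big_ind: _ => // [x y x0 y0|i _]; last exact: ram_gt0.
by rewrite lcmn_gt0 x0.
Qed.

Lemma adm_dvd_rQ i e : adm i e -> (denq e %| r%:Z)%Z.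
Proof. by move=> /adm_dvd /dvdz_trans; apply; exact: ram_dvd_rQ. Qed.

Lemma coef_le_KQ i e : coef (q i) e != 0 -> e <= K.
Proof.
move=> e0; apply: (@le_trans _ _ (slope (q i))); last exact: le_bigmax.
have [_ sk _] := slope_spec _ (q i).
by rewrite leNgt; apply/negP => /sk /eqP; rewrite (negbTE e0).
Qed.

(** A non-integral admissible exponent is bounded by a level, hence by [K]; an integer less than
    [eta] is at most the floor of [K]. *)
Lemma adm_le_KQ i e : adm i e -> e < Defs.eta q -> e <= K.
Proof.
move=> /andP[e0 /orP[d1|/hasP[l lL /andP[el _]]]]; last first.
  by move=> _; apply: le_trans el _; move: lL; rewrite mem_levels => /and3P[_ /coef_le_KQ].
have /intrP[z ->] : e \is a Num.int by rewrite Qint_def.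
by rewrite /Defs.eta ltr_int ltzD1 floor_ge_int.
Qed.

Lemma KQ_lt_eta : K < Defs.eta q.
Proof. exact: floorD1_gt. Qed.

Lemma KQ_ge0 : 0 <= K.
Proof. exact: bigmax_ge_id. Qed.

(** * The exponents that carry coordinates of B(Q) *)

Definition expo (t : 'I_s) : rat := t.+1%:R / r%:R.

Lemma expo_gt0 t : 0 < expo t.
Proof. by rewrite divr_gt0// ltr0n rQ_gt0. Qed.

Lemma expo_inj : injective expo.
Proof.
have r0 : r%:R != 0 :> rat by rewrite pnatr_eq0 -lt0n rQ_gt0.
move=> t t' /(divIf r0) /eqP; rewrite eqr_nat eqSS => /eqP tt'; exact: val_inj.
Qed.

Lemma rat_of_dvd_rQ e : 0 < e -> (denq e %| r%:Z)%Z -> exists t : nat, e = t.+1%:R / r%:R.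
Proof.
move=> e0; rewrite -rat_int_mul => /intrP[z zE].
have r0 : 0 < r%:R :> rat by rewrite ltr0n rQ_gt0.
have : (0 : rat) < z%:~R by rewrite -zE mulr_gt0.
rewrite ltr0z; case: z zE => [[|t]|//] // zE _; exists t.
by rewrite -[t.+1%:R]zE mulrC mulKf// gt_eqF.
Qed.

Lemma expo_ex e : 0 < e -> (denq e %| r%:Z)%Z -> e <= K -> exists t, e = expo t.
Proof.
move=> e0 /(rat_of_dvd_rQ _ e0)[t ->] tK.
have r0 : 0 < r%:R :> rat by rewrite ltr0n rQ_gt0.
(* Coordinate [t] stands for the exponent (t+1)/r, so [t < s] amounts to t+1 <= K r. *)
have ts : (t < s)%N.
  rewrite /sQ -ltz_nat gez0_abs ?floor_ge0 ?mulr_ge0 ?KQ_ge0 ?ler0n//.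
  by rewrite -lez1D floor_ge_int -[X in X <= _]/(t.+1%:R) -ler_pdivrMr.
by exists (Ordinal ts).
Qed.

Lemma adm_expo i e : adm i e -> e <= K -> exists t, e = expo t.
Proof. move=> ie eK; exact: (expo_ex _ (adm_gt0 _ _ ie) (adm_dvd_rQ _ _ ie)). Qed.

Lemma coef_expo i e : coef (q i) e != 0 -> exists t, e = expo t.
Proof. by move=> e0; apply: (adm_expo i); [exact: coef_adm|exact: coef_le_KQ e0]. Qed.

Lemma coef_qa_expo (a : 'I_m * 'I_s -> R[i]) i t : coef (qa a i) (expo t) = a (i, t).
Proof.
rewrite /coef big_map big_enum_cond /= (big_pred1 t)// => t'.
by rewrite -/(expo t') (inj_eq expo_inj).
Qed.

Lemma coef_qa_neq0 (a : 'I_m * 'I_s -> R[i]) i e :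
  coef (qa a i) e != 0 -> exists t, e = expo t.
Proof. by move=> /coef_exps; rewrite /exps -map_comp => /mapP[t _ ->]; exists t. Qed.

(** * The equations of B(Q), one exponent at a time *)

(** In the last clause the divisibilities say that the powers [k] and [l] act alike on the common
    part above [e]; unlike in [BQ], these powers are unbounded. *)
Definition fission_cond (a : 'I_m * 'I_s -> R[i]) :=
  [/\ forall i e, ~~ adm i e -> coef (qa a i) e = 0,
      forall i e, e \in levels (q i) -> coef (qa a i) e != 0,
      forall i j e, agree_ge i j e -> coef (qa a i) e = coef (qa a j) e &
      forall i j e (k l : nat), 0 < e -> agree_gt i j e ->
        coef (q i) e != coef (q j) e ->
        (forall e', e < e' -> coef (q i) e' != 0 -> (denq e' %| k%:Z - l%:Z)%Z) ->
        coef (qa a i) e * zeta R (k%:R * e) != coef (qa a j) e * zeta R (l%:R * e)].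

(** Each clause is the slope condition for well-chosen powers: 0 and [ram_above] with [i = j] for
    the first two, 0 and 0 for the third, and [k], [l] reduced modulo the ramifications for the
    last. *)
Lemma fission_cond_of_BQ a : BQ a -> fission_cond a.
Proof.
move=> B.
have Rle i e : (ram_above R (q i) e <= ram (q i))%N.
  by rewrite dvdn_leq ?ram_gt0// ram_above_dvd_ram.
have P0 i e : ~~ adm i e -> coef (qa a i) e = 0.
  move=> nie; apply/eqP/negPn/negP => a0.
  have e0 : 0 < e by have [t ->] := coef_qa_neq0 _ _ _ a0; exact: expo_gt0.
  move: nie; rewrite inA_levels e0 /= negb_or negbK => /andP[nu /eqP c0].
  have [_ sk _] := slope_spec _ (diff (sig 0 (qa a i)) (sig (ram_above R (q i) e) (qa a i))).
  have := B i i 0%N (ram_above R (q i) e) isT (Rle _ _) => sE.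
  rewrite sE in sk.
  (* The power [ram_above] fixes the part above [e], and [q i] has no term at [e]; it would move a
     term of [qa a i] there. *)
  have /sk : slope (diff (sig 0 (q i)) (sig (ram_above R (q i) e) (q i))) < e.
    apply: slope_lt => // k; rewrite coef_diff_sig le_eqVlt => /predU1P[<-|ek].
      by rewrite c0 !mul0r subrr.
    have [->|k0] := eqVneq (coef (q i) k) 0; first by rewrite !mul0r subrr.
    apply/eqP; rewrite subr_eq0; apply/eqP; congr (_ * _); apply/eqP.
    by rewrite zeta_natM_eq sub0r rpredN den_dvd_ram_above.
  rewrite coef_diff_sig => /eqP; rewrite subr_eq0 (inj_eq (mulfI a0)).
  by rewrite zeta_natM_eq sub0r rpredN; apply/negP.
split=> //.
- move=> i e; rewrite mem_levels => /and3P[e0 c0 nu].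
  have := B i i 0%N (ram_above R (q i) e) isT (Rle _ _).
  rewrite [RHS](_ : _ = e).
    have [_ _] := slope_spec _ (diff (sig 0 (qa a i)) (sig (ram_above R (q i) e) (qa a i))).
    move=> + sE; rewrite sE => /(_ e0); apply: contraNneq => a0.
    by rewrite coef_diff_sig a0 !mul0r subrr.
  apply: slope_eq; first exact: ltW.
    move=> k ek; rewrite coef_diff_sig.
    have [->|k0] := eqVneq (coef (q i) k) 0; first by rewrite !mul0r subrr.
    apply/eqP; rewrite subr_eq0; apply/eqP; congr (_ * _); apply/eqP.
    by rewrite zeta_natM_eq sub0r rpredN den_dvd_ram_above.
  move=> _; rewrite coef_diff_sig subr_eq0 (inj_eq (mulfI c0)).
  by rewrite zeta_natM_eq sub0r rpredN.
- move=> i j e ij; have [e0|e0] := ltP 0 e; last first.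
    suff z i' : coef (qa a i') e = 0 by rewrite !z.
    by apply: P0; apply/negP => /adm_gt0; rewrite ltNge e0.
  have [_ sk _] := slope_spec _ (diff (sig 0 (qa a i)) (sig 0 (qa a j))).
  rewrite B// in sk; have /sk : slope (diff (sig 0 (q i)) (sig 0 (q j))) < e.
    apply: slope_lt => // k ek; by rewrite coef_diff_sig ij// subrr.
  by rewrite coef_diff_sig !mul0r zeta0 !mulr1 => /eqP; rewrite subr_eq0 => /eqP.
- move=> i j e k l e0 ij cij kl.
  have qamod i' (x : nat) : coef (qa a i') e * zeta R ((x %% ram (q i'))%N%:R * e) =
      coef (qa a i') e * zeta R (x%:R * e).
    have [->|/eqP a0] := eqVneq (coef (qa a i') e) 0; first by rewrite !mul0r.
    rewrite zeta_modn// adm_dvd//; apply/negPn/negP => /P0 //.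
  have qmod i' (x : nat) e' : coef (q i') e' * zeta R ((x %% ram (q i'))%N%:R * e') =
      coef (q i') e' * zeta R (x%:R * e').
    have [->|a0] := eqVneq (coef (q i') e') 0; first by rewrite !mul0r.
    by rewrite zeta_modn// den_dvd_ram.
  have kij e' : e < e' -> coef (q i) e' * zeta R (k%:R * e') =
      coef (q j) e' * zeta R (l%:R * e').
    move=> ee'; rewrite -ij//.
    have [->|k0] := eqVneq (coef (q i) e') 0; first by rewrite !mul0r.
    by congr (_ * _); apply/eqP; rewrite zeta_natM_eq kl.
  have := B i j _ _ (ltnW (ltn_pmod k (ram_gt0 R (q i))))
                    (ltnW (ltn_pmod l (ram_gt0 R (q j)))).
  rewrite [RHS](_ : _ = e).
    have [_ _] := slope_spec _ (diff (sig (k %% ram (q i)) (qa a i))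
                                     (sig (l %% ram (q j)) (qa a j))).
    by move=> + sE; rewrite sE => /(_ e0); rewrite coef_diff_sig !qamod subr_eq0.
  apply: slope_eq; first exact: ltW.
    by move=> e' ee'; rewrite coef_diff_sig !qmod kij// subrr.
  (* Conjugates equal at [e] as well would agree from [e] up, which by compatibility forces equal
     coefficients at [e]. *)
  move=> _; rewrite coef_diff_sig !qmod subr_eq0; apply: contra cij => /eqP E.
  apply/eqP; apply: (agree_of_sig i j e k l); last exact: lexx.
  by move=> e'; rewrite le_eqVlt => /predU1P[<-//|]; exact: kij.
Qed.

(** Let [e] be the slope for Q. Above [e] the factors [q i] and [q j] agree, and the denominators of
    their exponents divide [k - l]; so do those of all admissible exponents above [e], hence the
    conjugates of Q_a agree there too. *)
Lemma BQ_of_fission_cond a : fission_cond a -> BQ a.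
Proof.
move=> [P0 P1 P2 P3] i j k l _ _.
have [s0 sk sn0] := slope_spec _ (diff (sig k (q i)) (sig l (q j))).
move: (slope _) s0 sk sn0 => e e0 ek en0.
have kij e' : e < e' -> coef (q i) e' * zeta R (k%:R * e') =
    coef (q j) e' * zeta R (l%:R * e').
  by move=> /ek; rewrite coef_diff_sig => /eqP; rewrite subr_eq0 => /eqP.
have ij : agree_gt i j e.
  move=> e' ee'; apply: (agree_of_sig i j e' k l); last exact: lexx.
  by move=> e'' e'e''; apply: kij; apply: lt_le_trans e'e''.
have kl e' : e < e' -> coef (q i) e' != 0 -> (denq e' %| k%:Z - l%:Z)%Z.
  move=> ee' c0; rewrite -(zeta_natM_eq R) -(inj_eq (mulfI c0)).
  by rewrite kij// ij.
apply: slope_eq => // [e' ee'|{}e0].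
  apply/eqP; rewrite coef_diff_sig subr_eq0 -(P2 i j); last first.
    by move=> e'' e'e''; apply: ij; apply: lt_le_trans e'e''.
  have [->|a0] := eqVneq (coef (qa a i) e') 0; first by rewrite !mul0r.
  have : adm i e' by apply: contraNT a0 => /P0 ->.
  rewrite (inj_eq (mulfI a0)) zeta_natM_eq inA_levels => /andP[_ /orP[u|]]; last exact: kl.
  by apply: unramP u _ => e'' e'e''; apply: kl; apply: lt_trans e'e''.
move: (en0 e0); rewrite !coef_diff_sig !subr_eq0.
(* Different coefficients at [e] are a branching. Equal ones are nonzero, and the denominator of [e]
   does not divide [k - l], so [e] is a level. *)
have [cij|cij _] := eqVneq (coef (q i) e) (coef (q j) e); last exact: P3.
have [c0|c0] := eqVneq (coef (q i) e) 0; first by rewrite -cij c0 !mul0r eqxx.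
rewrite -cij (inj_eq (mulfI c0)) zeta_natM_eq => nkl.
have aij : agree_ge i j e by move=> e'; rewrite le_eqVlt => /predU1P[<-//|]; exact: ij.
have a0 : coef (qa a i) e != 0.
  apply: P1; rewrite mem_levels e0 c0 /=; apply: contra nkl => /unramP; apply.
  exact: kl.
by rewrite -(P2 _ _ _ aij) (inj_eq (mulfI a0)) zeta_natM_eq.
Qed.

Lemma BQ_a0 : BQ (@a0 R m q).
Proof.
have cE i e : coef (qa (@a0 R m q) i) e = coef (q i) e.
  have [c0|/coef_expo [t ->]] := eqVneq (coef (q i) e) 0; last by rewrite coef_qa_expo.
  rewrite c0; apply/eqP/negPn/negP => a0; move: (a0).
  have [t tE] := coef_qa_neq0 _ _ _ a0.
  by rewrite tE coef_qa_expo /Defs.a0 /= -/(expo t) -tE c0 eqxx.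
move=> i j k l _ _; have [s0 sk sn0] := slope_spec _ (diff (sig k (q i)) (sig l (q j))).
apply: slope_eq => //.
  by move=> e /sk; rewrite !coef_diff_sig !cE.
by move=> /sn0; rewrite !coef_diff_sig !cE.
Qed.

Lemma expo_le_KQ t : expo t <= K.
Proof.
have r0 : 0 < r%:R :> rat by rewrite ltr0n rQ_gt0.
rewrite ler_pdivrMr//; apply: le_trans (floor_le _).
have /gez0_abs <- : 0 <= Num.floor (K * r%:R) by rewrite floor_ge0 mulr_ge0 ?KQ_ge0.
by rewrite -[(Posz _)%:~R]/(_%:R) ler_nat; exact: ltn_ord.
Qed.

(** * Nodes of the fission tree and their matching with coordinates *)

Lemma inAQ_gt0 k : inAQ q k -> 0 < k.
Proof. by move=> [i /adm_gt0]. Qed.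

Lemma predA_inj k k1 k2 : inAQ q k1 -> inAQ q k2 ->
  predA q k k1 -> predA q k k2 -> k1 = k2.
Proof.
move=> A1 A2 [_ kk1 max1] [_ kk2 max2]; have [k12|k21|//] := ltgtP k1 k2.
  by have := max2 _ A1 k12; rewrite leNgt kk1.
by have := max1 _ A2 k21; rewrite leNgt kk2.
Qed.

Lemma predA_fun k k1 k2 : predA q k1 k -> predA q k2 k -> k1 = k2.
Proof.
move=> [A1 k1k max1] [A2 k2k max2]; apply/eqP.
by rewrite eq_le max2// max1.
Qed.

(** Every exponent that occurs in some [q i] belongs to A(Q), so none lies strictly between
    consecutive heights. *)
Lemma agree_predA k k' i j : predA q k' k -> agree_ge i j k -> agree_gt i j k'.
Proof.
move=> [_ k'k kmax] ij e k'e; have [/ij//|ek] := leP k e.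
suff z i' : coef (q i') e = 0 by rewrite !z.
apply/eqP/negPn/negP => /coef_adm ie.
by have := kmax e (ex_intro _ i' ie) ek; rewrite leNgt k'e.
Qed.

(** A(Q) lies in the positive multiples of 1/r, so it has a least element above [e]; it is at most
    [eta], which belongs to A(Q) and exceeds [e]. *)
Lemma predA_ex i e : adm i e -> e <= K ->
  exists k, [/\ inAQ q k, predA q e k & k <= Defs.eta q].
Proof.
move=> ie eK; have r0 : 0 < r%:R :> rat by rewrite ltr0n rQ_gt0.
pose P t := `[< inAQ q (t.+1%:R / r%:R) /\ e < t.+1%:R / r%:R >].
have ltP t t' : (t'.+1%:R / r%:R < t.+1%:R / r%:R :> rat) = (t' < t)%N.
  by rewrite ltr_pM2r ?invr_gt0// ltr_nat.
have AP k : inAQ q k -> exists t : nat, k = t.+1%:R / r%:R.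
  by move=> [j jk]; apply: rat_of_dvd_rQ; [exact: adm_gt0 jk|exact: adm_dvd_rQ jk].
have Aeta : inAQ q (Defs.eta q).
  exists i; rewrite /inA /Defs.eta denq_int eqxx andbT ltr0z.
  by rewrite ltzD1 floor_ge0 KQ_ge0.
have [teta tetaE] := AP _ Aeta.
have Pex : exists t, P t.
  exists teta; apply/asboolP; rewrite -tetaE; split=> //.
  exact: le_lt_trans eK KQ_lt_eta.
have [t /asboolP[At et] tmin] := ex_minnP Pex.
exists (t.+1%:R / r%:R); split=> //.
  split=> //; first by exists i.
  move=> k Ak; have [t' E] := AP _ Ak; rewrite E ltP leNgt => t't; apply/negP => et'.
  have : P t' by apply/asboolP; rewrite -E in et' *.
  by move=> /tmin; rewrite leqNgt t't.
rewrite tetaE leNgt ltP -leqNgt; apply: tmin; apply/asboolP; rewrite -tetaE; split=> //.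
exact: le_lt_trans eK KQ_lt_eta.
Qed.

Lemma agree_class k S i j : isNode q k S -> i \in S -> (j \in S <-> agree_ge i j k).
Proof.
move=> [_ [i0 /isClassP Si0]] /Si0 ii0; rewrite Si0; split=> [ji0|ij].
  exact: agree_ge_trans ii0 (agree_ge_sym _ _ _ ji0).
exact: agree_ge_trans (agree_ge_sym _ _ _ ij) ii0.
Qed.

Lemma node_eq k S S' i : isNode q k S -> isNode q k S' -> i \in S -> i \in S' -> S = S'.
Proof.
move=> nS nS' iS iS'; apply/setP => x; apply/idP/idP.
  by move=> /(agree_class _ _ _ _ nS iS) /(agree_class _ _ _ _ nS' iS').
by move=> /(agree_class _ _ _ _ nS' iS') /(agree_class _ _ _ _ nS iS).
Qed.

Lemma child_spec k S W k' : isNode q k S -> childA q k S W -> predA q k' k ->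
  [/\ isNode q k' W, W \subset S, exists j, j \in W &
      forall j, j \in W -> adm j k'].
Proof.
move=> nS [k1 [p1 [j [jS cW]] [j' [j'W aj']]]] pk'.
have E := predA_fun _ _ _ p1 pk'; subst k1; have /isClassP cW' := cW.
have nW : isNode q k' W by split; [case: pk'|exists j].
have jW : j \in W by apply/cW'.
split=> //.
- apply/fintype.subsetP => x; rewrite (agree_class _ _ _ _ nW jW) => jx.
  apply/(agree_class _ _ _ _ nS jS); apply: agree_geW jx.
  by case: pk' => _ /ltW.
- by exists j.
- by move=> x /(agree_class _ _ _ _ nW j'W) /adm_agree <-.
Qed.

(* The coordinate [a_{i,t}] of [B(Q)] matches the coordinate of [B_v] at the
   admissible child [w] when [w] is the circle of the truncation of [q_i] at
   the exponent of [t]. *)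
Definition matches (it : 'I_m * 'I_s) (p : {v : Vflat q & ChV v}) :=
  it.1 \in proj1_sig (projT2 p) /\ predA q (expo it.2) (proj1_sig (projT1 p)).1.

(** The exponent determines the height of the parent by [predA_inj], and [i] then determines the
    circles at both heights. *)
Lemma matches_fun it p p' : matches it p -> matches it p' -> p = p'.
Proof.
case: p p' => [[[k S] HS] [W HW]] [[[k' S'] HS'] [W' HW']].
rewrite /matches /= => -[iW pk] [iW' pk'].
have [/= nS _] := HS; have [/= nS' _] := HS'.
have E : k = k' by apply: predA_inj pk pk'; [case: nS|case: nS'].
subst k'; have cW : childA q k S W := HW; have cW' : childA q k S' W' := HW'.
have [nW /fintype.subsetP WS _ _] := child_spec _ _ _ _ nS cW pk.
have [nW' /fintype.subsetP WS' _ _] := child_spec _ _ _ _ nS' cW' pk.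
have ES : S = S' by exact: node_eq nS nS' (WS _ iW) (WS' _ iW').
have EW : W = W' by exact: node_eq nW nW' iW iW'.
subst S' W'; have EH := Prop_irrelevance HS' HS; subst HS'.
by rewrite (Prop_irrelevance HW' HW).
Qed.

(** The bound [eta] on the heights enters here: a child has height less than [eta], hence at most
    [K], so that a coordinate exists for it. *)
Lemma matches_total p : exists it, matches it p.
Proof.
case: p => [[[k S] [nS kS]] [W cW]]; rewrite /matches /=.
have [k' [pk' _ _]] := cW.
have [_ _ [j jW] /(_ j jW) jk'] := child_spec _ _ _ _ nS cW pk'.
have [|t tE] := adm_expo j k' jk'.
  by apply: adm_le_KQ jk' _; case: pk' => _ k'k _; exact: (lt_le_trans k'k kS).
by exists (j, t); rewrite /= -tE.
Qed.

Lemma matches_adm i t p : matches (i, t) p -> adm i (expo t).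
Proof.
case: p => [[[k S] [nS kS]] [W cW]]; rewrite /matches /= => -[iW pk].
by have [_ _ _] := child_spec _ _ _ _ nS cW pk; apply.
Qed.

Lemma adm_matches i t : adm i (expo t) -> exists p, matches (i, t) p.
Proof.
move=> it; have [k [Ak pk ke]] := predA_ex _ _ it (expo_le_KQ t).
pose cl e := [set j | `[< agree_ge j i e >]].
have clP e : isClass q e i (cl e) by apply/isClassP => j; rewrite inE; split=> /asboolP.
have icl e : i \in cl e by rewrite inE; apply/asboolP.
have nS : isNode q (k, cl k).1 (k, cl k).2 by split=> //=; exists i.
have cW : childA q k (cl k) (cl (expo t)).
  by exists (expo t); split=> //; exists i.
exists (existT _ (exist _ (k, cl k) (conj nS ke)) (exist _ (cl (expo t)) cW)).
by split=> /=; [exact: icl|exact: pk].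
Qed.

Lemma matches_agree i j t p : matches (i, t) p ->
  matches (j, t) p <-> agree_ge i j (expo t).
Proof.
case: p => [[[k S] [nS kS]] [W cW]]; rewrite /matches /= => -[iW pk].
have [nW _ _ _] := child_spec _ _ _ _ nS cW pk.
by rewrite -(agree_class _ _ _ _ nW iW); split=> [[]|].
Qed.

(** Agreement above the exponent puts [j] in the parent, so its circle is an admissible child of the
    same node. *)
Lemma matches_sibling i j t v (w : ChV v) : matches (i, t) (existT _ v w) ->
  agree_gt i j (expo t) -> adm j (expo t) ->
  exists w' : ChV v, matches (j, t) (existT _ v w').
Proof.
case: v w => [[k S] [nS kS]] [W cW]; rewrite /matches /= => -[iW pk] ij jt.
have [_ /fintype.subsetP WS _ _] := child_spec _ _ _ _ nS cW pk.
have jS : j \in S.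
  apply/(agree_class _ _ _ _ nS (WS _ iW)) => e ke; apply: ij.
  by case: pk => _ + _ => /lt_le_trans; apply.
pose W' := [set x | `[< agree_ge x j (expo t) >]].
have jW' : j \in W' by rewrite inE; apply/asboolP.
have cW' : childA q k S W'.
  exists (expo t); split=> //; last by exists j.
  by exists j; split=> //; apply/isClassP => x; rewrite inE; split=> /asboolP.
by exists (exist _ W' cW').
Qed.

Definition coord_child (it : 'I_m * 'I_s) : option {v : Vflat q & ChV v} :=
  if pselect (exists p, matches it p) is left h then Some (projT1 (cid h)) else None.

Lemma coord_childP it p : coord_child it = Some p <-> matches it p.
Proof.
rewrite /coord_child; case: pselect => [h|nh]; last by split=> // ip; case: nh; exists p.
split=> [[<-]|ip]; first exact: projT2 (cid h).
by congr Some; apply: matches_fun ip; exact: projT2 (cid h).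
Qed.

Lemma coord_child_None i t : coord_child (i, t) = None -> ~~ adm i (expo t).
Proof. by move=> h; apply/negP => /adm_matches[p /coord_childP]; rewrite h. Qed.

Definition child_coord (v : Vflat q) (w : ChV v) : 'I_m * 'I_s :=
  projT1 (cid (matches_total (existT _ v w))).

Lemma child_coordP v w : matches (child_coord v w) (existT _ v w).
Proof. exact: projT2 (cid (matches_total (existT _ v w))). Qed.

Lemma child_coord_spec (v : Vflat q) (w : ChV v) k' : predA q k' (proj1_sig v).1 ->
  exists i t, [/\ child_coord v w = (i, t), i \in proj1_sig w & expo t = k'].
Proof.
have := child_coordP v w; case: (child_coord v w) => i t [/= iW pt] pk'.
by exists i, t; split=> //; exact: predA_fun pt pk'.
Qed.

(** * Comparison of the equations of B(Q) with those of the factors B_v *)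

(** No exponent lies strictly between [k'] and [k], so truncating at [k] keeps exactly the part
    above [k']. This part is common to all of [S], and the maximum in [RamN] is taken over a
    constant. *)
Lemma Nv_ram_above k S k' i : isNode q k S -> predA q k' k -> i \in S ->
  Nv q k S k' = (lcmn (ram_above R (q i) k') (absz (denq k')) %/ ram_above R (q i) k')%N.
Proof.
move=> nS pk' iS; suff RE : RamN q k S = ram_above R (q i) k' by rewrite /Nv RE.
have rE j : j \in S -> ram (trunc k (q j)) = ram_above R (q i) k'.
  move=> /(agree_class _ _ _ _ nS iS) /(agree_predA _ _ _ _ pk')/(ram_above_eq _ _ _ _) ->.
  have k'k : k' < k by case: pk'.
  apply/eqP; rewrite eqn_dvd; apply/andP; split;
    rewrite -[(_ %| _)%N]/(Posz _ %| Posz _)%Z.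
    apply/dvd_ram => e; rewrite coef_trunc; case: leP => [ke c0|]; last by rewrite eqxx.
    by apply: den_dvd_ram_above => //; apply: lt_le_trans ke.
  apply/dvd_ram_above => e k'e c0; apply: den_dvd_ram; rewrite coef_trunc.
  case: leP => // ek; case: pk' => _ _ /(_ e (ex_intro _ j (coef_adm _ _ c0)) ek).
  by rewrite leNgt k'e.
apply/eqP; rewrite eqn_leq; apply/andP; split.
  by apply/bigmax_leqP => j /rE ->.
by rewrite -(rE i iS); exact: leq_bigmax_cond.
Qed.

Lemma ram_above_gt0 i k : (0 < ram_above R (q i) k)%N.
Proof. exact: lcmden_gt0. Qed.

Lemma BV_of_fission_cond x (v : Vflat q) : fission_cond x ->
  BV (fun w => x (child_coord v w)).
Proof.
move=> [P0 P1 P2 P3] k' pk'; have [nS kS] := proj2_sig v.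
split=> [w [j [jW jL]]|u w uw].
  have [i [t [-> iW tE]]] := child_coord_spec v w k' pk'.
  have [nW _ _ _] := child_spec _ _ _ _ nS (proj2_sig w) pk'.
  rewrite -coef_qa_expo tE; apply/eqP/P1.
  by rewrite (levels_agree i j)//; apply/(agree_class _ _ _ _ nW iW).
have [i [t [-> iU tE]]] := child_coord_spec v u k' pk'.
have [j [t' [-> jW t'E]]] := child_coord_spec v w k' pk'.
have [nU /fintype.subsetP US _ _] := child_spec _ _ _ _ nS (proj2_sig u) pk'.
have [nW /fintype.subsetP WS _ _] := child_spec _ _ _ _ nS (proj2_sig w) pk'.
rewrite (Nv_ram_above _ _ _ _ nS pk' (US _ iU)).
(* Equal [N_v]-th powers differ by a Galois power that is a multiple of [ram_above]; it fixes the
   common part above [k'], against the last clause. *)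
move=> /(expr_eq_zetaP _ _ _ _ _ (ram_above_gt0 _ _))[t0].
rewrite -!coef_qa_expo tE t'E => E.
have ij : agree_ge i j (proj1_sig v).1 by apply/(agree_class _ _ _ _ nS (US _ iU)); exact: WS.
have ij' := agree_predA _ _ _ _ pk' ij.
have k'0 : 0 < k' by apply: inAQ_gt0; case: pk'.
have cij : coef (q i) k' != coef (q j) k'.
  apply/eqP => c; apply: uw; suff iW : i \in proj1_sig w by exact: node_eq nU nW iU iW.
  apply/(agree_class _ _ _ _ nW jW); apply: agree_ge_sym => e.
  by rewrite le_eqVlt => /predU1P[<-//|]; exact: ij'.
suff /(P3 i j k' 0%N (t0 * ram_above R (q i) k')%N k'0 ij' cij) :
    forall e, k' < e -> coef (q i) e != 0 ->
      (denq e %| 0%:Z - (t0 * ram_above R (q i) k')%N%:Z)%Z.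
  by rewrite mul0r zeta0 mulr1 E eqxx.
by move=> e k'e c0; rewrite sub0r rpredN PoszM dvdz_mull// den_dvd_ram_above.
Qed.

Lemma BQ_prodP x : BQ x <-> (forall v, BV (fun w => x (child_coord v w))) /\
  forall it, x it = if coord_child it is Some (existT v w) then x (child_coord v w) else 0.
Proof.
split=> [/fission_cond_of_BQ Px|[H1 H2]].
  split=> [v|[i t]]; first exact: BV_of_fission_cond.
  have [P0 P1 P2 P3] := Px.
  case E: coord_child => [[v w]|]; last first.
    by rewrite -coef_qa_expo P0// coord_child_None.
  move/coord_childP : E => itvw; have pt := itvw.2.
  have [j [t' [cE jW /expo_inj t'E]]] := child_coord_spec v w _ pt.
  rewrite cE t'E -!coef_qa_expo; apply: P2; apply/(matches_agree _ _ _ _ itvw).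
  by split.
apply: BQ_of_fission_cond.
have xE i t v w : matches (i, t) (existT _ v w) -> x (i, t) = x (child_coord v w).
  by move=> /coord_childP E; rewrite H2 E.
have P0 i e : ~~ adm i e -> coef (qa x i) e = 0.
  move=> nie; apply/eqP/negPn/negP => a0; have [t tE] := coef_qa_neq0 _ _ _ a0.
  move: a0; rewrite tE coef_qa_expo H2; case E: coord_child => [p|]; last by rewrite eqxx.
  by move/coord_childP/matches_adm : E; rewrite -tE (negbTE nie).
have P1 i e : e \in levels (q i) -> coef (qa x i) e != 0.
  move=> eL; have := eL; rewrite mem_levels => /and3P[_ c0 _].
  have ie := coef_adm _ _ c0; have [t tE] := coef_expo _ _ c0; subst e.
  have [[v w] itw] := adm_matches _ _ ie.
  rewrite coef_qa_expo (xE _ _ _ _ itw); have [/= iW pt] := itw.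
  by have [h _] := H1 v (expo t) pt; apply/eqP/h; exists i.
split=> //.
- move=> i j e ij; have [ie|nie] := boolP (adm i e); last first.
    by rewrite !P0 -?(adm_agree _ _ _ ij).
  have [[t tE]|nt] := pselect (exists t, e = expo t).
    subst e; have [[v w] itw] := adm_matches _ _ ie.
    rewrite !coef_qa_expo (xE _ _ _ _ itw) (xE j t v w)//.
    exact/(matches_agree _ _ _ _ itw).
  suff z i' : coef (qa x i') e = 0 by rewrite !z.
  by apply/eqP/negPn/negP => /coef_qa_neq0.
- move=> i j e k l e0 ij cij kl.
  have uij : unram R (q i) e = unram R (q j) e by exact: unram_eq.
  (* If both are admissible, they give two children of one node. If only one is, the other
     coefficient vanishes and [e] is a level of the first. If neither is, both factors lack the
     exponent [e], against [cij]. *)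
  have [ie|nie] := boolP (adm i e); have [je|nje] := boolP (adm j e).
  + have [t tE] : exists t, e = expo t.
      have [c0|/coef_expo//] := eqVneq (coef (q i) e) 0.
      by apply: (coef_expo j); rewrite -c0 eq_sym.
    subst e; have [[v w] iw] := adm_matches _ _ ie.
    have [w' jw'] := matches_sibling _ _ _ _ _ iw ij je.
    rewrite !coef_qa_expo (xE _ _ _ _ iw) (xE _ _ _ _ jw').
    have [/= iW pt] := iw; have [/= jW' _] := jw'; have [nS _] := proj2_sig v.
    have [nW /fintype.subsetP WS _ _] := child_spec _ _ _ _ nS (proj2_sig w) pt.
    have ww' : proj1_sig w <> proj1_sig w'.
      move=> E; rewrite -E in jW'; move/eqP: cij; apply.
      by move/(agree_class _ _ _ _ nW iW) : jW'; apply.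
    have [_ /(_ w w' ww')] := H1 v (expo t) pt.
    set N := Nv _ _ _ _ => nE; apply/eqP => E; apply: nE.
    have := congr1 (fun z => z ^+ N) E; rewrite !exprMn !zetaX.
    (* The number [N * ram_above] is an lcm divisible by the denominator of the exponent, and
       [ram_above] divides [k - l]; so raising to the power [N] erases the Galois action. *)
    suff -> : zeta R (N%:R * (k%:R * expo t)) = zeta R (N%:R * (l%:R * expo t)).
      by move/(mulIf (zeta_neq0 _ _)).
    apply/eqP; rewrite !(mulrA _ _ (expo t)) -!natrM zeta_natM_eq !PoszM -mulrBr.
    rewrite /N (Nv_ram_above _ _ _ _ nS pt (WS _ iW)).
    move/dvd_ram_above : kl => /dvdzP[z ->]; rewrite mulrCA dvdz_mull// -PoszM.
    by rewrite divnK ?dvdn_lcml// dvdzE /= dvdn_lcmr.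
  + have aj : coef (qa x j) e = 0 by exact: P0.
    move: nje; rewrite inA_levels e0 /= negb_or negbK -uij => /andP[nu /eqP cj].
    by rewrite aj mul0r mulf_neq0 ?zeta_neq0// P1// mem_levels e0 nu -cj cij.
  + have ai : coef (qa x i) e = 0 by exact: P0.
    move: nie; rewrite inA_levels e0 /= negb_or negbK uij => /andP[nu /eqP ci].
    by rewrite ai mul0r eq_sym mulf_neq0 ?zeta_neq0// P1// mem_levels e0 nu -ci eq_sym cij.
  + case/negP: nie; apply: coef_adm; apply: contra nje => /eqP ci.
    by apply: coef_adm; rewrite -ci eq_sym.
Qed.

(** * Identification of the factors with configuration spaces *)

(** All children of [v] share the part above their height, so whether that height is unramified does
    not depend on the child. If it is, no child is mandatory and [N_v = 1]; otherwise an admissible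
    child has a nonzero coefficient there and is mandatory. *)
Lemma factor_model (v : Vflat q) (b : ChV v -> R[i]) : BV b ->
  (exists (k : nat) (x : 'I_k -> R[i]), Xconf x /\ pi1_iso (@BV R m q v) b (@Xconf R k) x) \/
  (exists (k N : nat) (x : 'I_k -> R[i]),
     [/\ (0 < N)%N, Xstar N x & pi1_iso (@BV R m q v) b (@Xstar R k N) x]).
Proof.
move=> bB; have [nS kS] := proj2_sig v.
pose k := (proj1_sig v).1; pose S := (proj1_sig v).2.
pose A := [set W | `[< childA q k S W >]].
have eA (t : 'I_#|A|) : childA q k S (enum_val t).
  by have := enum_valP t; rewrite inE => /asboolP.
have e'A (w : ChV v) : proj1_sig w \in A by rewrite inE; apply/asboolP; exact: proj2_sig w.
pose e t : ChV v := exist _ (enum_val t) (eA t).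
pose e' (w : ChV v) : 'I_#|A| := enum_rank_in (e'A w) (proj1_sig w).
have eK : cancel e e' by move=> t; exact: enum_valK_in.
have e'K : cancel e' e.
  move=> w; have : proj1_sig (e (e' w)) = proj1_sig w by exact: enum_rankK_in.
  by case: (e (e' w)) (w) => [W cW] [W' cW'] /= E; exact: eq_exist.
have e_neq t t' : t <> t' -> proj1_sig (e t) <> proj1_sig (e t').
  by move=> tt' /enum_val_inj.
have sv_inj (u w : ChV v) : proj1_sig u <> proj1_sig w -> e' u <> e' w.
  by move=> uw /(can_inj e'K) E; apply: uw; rewrite E.
(* At the lowest height there are no children, and B_v is the one-point space [Xconf] with no
   coordinates. *)
have [[k' pk']|np] := pselect (exists k', predA q k' k); last first.
  left; exists #|A|, (b \o e).
  have vac (t : 'I_#|A|) : False by have [k' [pk' _ _]] := eA t; apply: np; exists k'.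
  split; first by move=> t; have := vac t.
  apply: (pi1_iso_reindex _ _ _ _ e') => // x; split=> _; first by move=> t; have := vac t.
  by move=> k' pk'; case: np; exists k'.
have [_ [i iS0]] := nS.
have iS : i \in S by apply/iS0/circ_trunc.
have NE := Nv_ram_above _ _ _ _ nS pk' iS.
have Rg0 := ram_above_gt0 i k'.
have d0 : (0 < absz (denq k'))%N by rewrite absz_gt0 denq_neq0.
have uS j : j \in S -> unram R (q i) k' = unram R (q j) k'.
  by move=> /(agree_class _ _ _ _ nS iS)/(agree_predA _ _ _ _ pk'); exact: unram_eq.
have BVE x : @BV R m q v x <-> (forall w : ChV v, mandatory q k' (proj1_sig w) -> x w <> 0) /\
   (forall u w : ChV v, proj1_sig u <> proj1_sig w -> x u ^+ Nv q k S k' <> x w ^+ Nv q k S k').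
  by split=> [/(_ k' pk')//|h k1 pk1]; rewrite (predA_fun _ _ _ pk1 pk').
have [u|nu] := boolP (unram R (q i) k').
  have N1 : Nv q k S k' = 1%N.
    by apply/eqP; rewrite NE lcmn_div_eq1.
  have XP x : @BV R m q v x <-> Xconf (x \o e).
    rewrite BVE N1; split=> [[_ h] t t' /e_neq /h//|h]; split=> [w [j [jW]]|w w' /sv_inj ww'].
      have [_ /fintype.subsetP WS _ _] := child_spec _ _ _ _ nS (proj2_sig w) pk'.
      by rewrite mem_levels -(uS _ (WS _ jW)) u !andbF.
    by have := h _ _ ww'; rewrite /= !e'K.
  left; exists #|A|, (b \o e); split; first exact/XP.
  exact: (pi1_iso_reindex _ _ _ _ e').
have N0 : (0 < Nv q k S k')%N.
  by rewrite NE divn_gt0// dvdn_leq ?dvdn_lcml// lcmn_gt0 Rg0.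
have man (w : ChV v) : mandatory q k' (proj1_sig w).
  have [_ /fintype.subsetP WS [j jW] /(_ j jW)] := child_spec _ _ _ _ nS (proj2_sig w) pk'.
  rewrite inA_levels -(uS _ (WS _ jW)) (negbTE nu) /= => /andP[k'0 c0].
  by exists j; split=> //; rewrite mem_levels k'0 c0 -(uS _ (WS _ jW)).
have XP x : @BV R m q v x <-> Xstar (Nv q k S k') (x \o e).
  rewrite BVE; split=> [[h1 h2]|[h1 h2]].
    split=> [t|t t' z tt' zN E]; first exact: h1 (man _).
    by apply: (h2 _ _ (e_neq _ _ tt')); move: E => /= ->; rewrite exprMn zN mul1r.
  have x0 w : x w <> 0 by have := h1 (e' w); rewrite /= e'K.
  split=> [w _|w w' ww' E]; first exact: x0.
  (* Two nonzero numbers with equal [N]-th powers have an [N]-th root of unity as quotient. *)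
  have := h2 _ _ (x w / x w') (sv_inj _ _ ww').
  rewrite /= !e'K expr_div_n E divff ?expf_neq0//; last exact/eqP/x0.
  by move=> /(_ erefl); apply; rewrite divfK//; exact/eqP/x0.
right; exists #|A|, (Nv q k S k'), (b \o e); split=> //; first exact/XP.
exact: (pi1_iso_reindex _ _ _ _ e').
Qed.

End FissionTree.

Theorem mainTheorem16 (R : realType) (m : nat) (n : 'I_m -> nat)
    (q : 'I_m -> expf R) :
  compatible_pit n q ->
  exists b : forall v : Vflat q, ChV v -> R[i],
    [/\ (forall v, @BV R m q v (b v)),
        @pi1_iso_prod R _ (@BQ R m q) (@a0 R m q) (Vflat q) (@ChV R m q) (@BV R m q) b &
        (forall v : Vflat q,
           pi1_trivial (@BV R m q v) (b v)
        \/ (exists (k : nat) (x : 'I_k -> R[i]),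
              Xconf x /\ pi1_iso (@BV R m q v) (b v) (@Xconf R k) x)
        \/ (exists (k N : nat) (x : 'I_k -> R[i]),
              [/\ (0 < N)%N, Xstar N x & pi1_iso (@BV R m q v) (b v) (@Xstar R k N) x]))].
Proof.
move=> Qc; have Ba0 := BQ_a0 _ _ _ _ Qc.
(* The base point of each factor consists of the coefficients of Q at the matching coordinates. *)
have BVb v : BV (fun w => a0 (child_coord _ _ _ _ Qc v w)).
  by have /(BQ_prodP _ _ _ _ Qc)[+ _] := Ba0; apply.
exists (fun v w => a0 (child_coord _ _ _ _ Qc v w)); split=> //; last first.
  by move=> v; right; exact: (factor_model _ _ _ _ Qc v _ (BVb v)).
apply: (@pi1_iso_prod_coord R _ _ id _ _ _ _ _ _ (coord_child _ _ _)) => //.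
- by move=> i; exists i.
- by move=> v w; apply/(coord_childP _ _ _ _ Qc); exact: child_coordP.
- by move=> x; exact: BQ_prodP.
Qed.
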